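(* Let $r,q$ be natural numbers, $a=(a_1,\dots,a_r)\in\mathbb{C}^{r}$, $k=(k_1,\dots,k_r),\,p=(p_1,\dots,p_r)\in(\mathbb{R}^{+})^{r}$, $s=(s_1,\dots,s_q),\,t=(t_1,\dots,t_q)\in(\mathbb{R}^{+})^{q}$, and $b=(b_1,\dots,b_q)\in\mathbb{C}^{q}$ such that no $b_i/s_i$ is zero or a negative integer. Then for every $x\in\mathbb{C}$ for which the defining series converges, $$F(a,p,k;b,t,s;x)=F\left(\frac{a}{k};\frac{b}{s};\frac{\prod_{i=1}^{r}p_i}{\prod_{j=1}^{q}t_j}\,x\right),$$ where the right-hand side is the classical generalized hypergeometric function with numerator parameters $\frac{a_1}{k_1},\dots,\frac{a_r}{k_r}$ and denominator parameters $\frac{b_1}{s_1},\dots,\frac{b_q}{s_q}$.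
   Context: For positive reals $p,k$ and $z\in\mathbb{C}$, the p-k Pochhammer symbol is ${}_{p}(z)_{n,k}=\left(\frac{zp}{k}\right)\left(\frac{zp}{k}+p\right)\cdots\left(\frac{zp}{k}+(n-1)p\right)$, with ${}_{p}(z)_{0,k}=1$. The p-k hypergeometric function is $$F(a,p,k;b,t,s;x)=\sum_{n=0}^{\infty}\frac{\prod_{i=1}^{r}{}_{p_i}(a_i)_{n,k_i}}{\prod_{j=1}^{q}{}_{t_j}(b_j)_{n,s_j}}\,\frac{x^{n}}{n!}.$$ The classical generalized hypergeometric function is $F(\alpha;\beta;z)=\sum_{n=0}^{\infty}\frac{\prod_{i=1}^{r}(\alpha_i)_n}{\prod_{j=1}^{q}(\beta_j)_n}\frac{z^n}{n!}$, with $(\alpha)_n=\alpha(\alpha+1)\cdots(\alpha+n-1)$, $(\alpha)_0=1$. The p-k series converges for all $x$ if $r\le q$, and for $|x|<\left|\frac{t_1\cdots t_q}{p_1\cdots p_r}\right|$ if $r=q+1$. *)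

(* Defs.v *)
From HB Require Import structures.
From mathcomp Require Import all_boot all_order all_algebra complex.
From mathcomp Require Import boolp classical_sets reals topology normedtype sequences.

Set Implicit Arguments.
Unset Strict Implicit.
Unset Printing Implicit Defensive.

Import Order.TTheory GRing.Theory Num.Theory numFieldNormedType.Exports.

Local Open Scope ring_scope.
Local Open Scope complex_scope.
Local Open Scope classical_set_scope.

(* The complex numbers are R[i] for an arbitrary R : realType.  Their topology
   (that of the modulus) is attached to the alias R[i]^o, which is why the
   terms and the sums of the series below are typed in R[i]^o. *)

Definition pk_pochhammer (R : realType) (p k : R) (z : R[i]) (n : nat) : R[i] :=
  \prod_(i < n) (z * p%:C / k%:C + i%:R * p%:C).

Definition pochhammer (R : realType) (z : R[i]) (n : nat) : R[i] :=
  \prod_(i < n) (z + i%:R).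

Definition pk_hypergeometric_term (R : realType) (r q : nat)
    (a : 'I_r -> R[i]) (p k : 'I_r -> R) (b : 'I_q -> R[i]) (t s : 'I_q -> R)
    (x : R[i]) (n : nat) : R[i]^o :=
  (\prod_(i < r) pk_pochhammer (p i) (k i) (a i) n)
    / (\prod_(j < q) pk_pochhammer (t j) (s j) (b j) n) * (x ^+ n / n`!%:R).

Definition hypergeometric_term (R : realType) (r q : nat)
    (alpha : 'I_r -> R[i]) (beta : 'I_q -> R[i])
    (z : R[i]) (n : nat) : R[i]^o :=
  (\prod_(i < r) pochhammer (alpha i) n)
    / (\prod_(j < q) pochhammer (beta j) n) * (z ^+ n / n`!%:R).

(* limn is total: the two functions below carry the sum of the series only
   where the series converges. *)
Definition pk_hypergeometric (R : realType) (r q : nat)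
    (a : 'I_r -> R[i]) (p k : 'I_r -> R) (b : 'I_q -> R[i]) (t s : 'I_q -> R)
    (x : R[i]) : R[i]^o :=
  limn (series (pk_hypergeometric_term a p k b t s x)).

Definition hypergeometric (R : realType) (r q : nat)
    (alpha : 'I_r -> R[i]) (beta : 'I_q -> R[i]) (z : R[i]) : R[i]^o :=
  limn (series (hypergeometric_term alpha beta z)).

(* Main.v *)
Require Import Defs.
From HB Require Import structures.
From mathcomp Require Import all_boot all_order all_algebra complex.
From mathcomp Require Import boolp classical_sets reals topology normedtype sequences.

Set Implicit Arguments.
Unset Strict Implicit.
Unset Printing Implicit Defensive.

Import Order.TTheory GRing.Theory Num.Theory numFieldNormedType.Exports.

Local Open Scope ring_scope.
Local Open Scope complex_scope.
Local Open Scope classical_set_scope.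

(** Each of the [n] factors of a p-k Pochhammer symbol is [p] times the matching factor of the
    classical symbol at [z / k], so the symbol is [p ^ n] times a classical one. In the general term
    these powers collect into the [n]-th power of the ratio of the products of the [p i] and the
    [t j], which [x ^+ n] absorbs. The two series thus agree term by term
    ([pk_hypergeometric_termE]), and so do their convergence and sums. *)

Lemma pk_pochhammerE (R : realType) (p k : R) (z : R[i]) (n : nat) :
  pk_pochhammer p k z n = p%:C ^+ n * pochhammer (z / k%:C) n.
Proof.
(* The power becomes a constant product over ['I_n], to be merged factor by factor. *)
rewrite /pk_pochhammer /pochhammer -[in p%:C ^+ n](card_ord n) -prodr_const.
rewrite -big_split; apply: eq_bigr => i _ /=.
by rewrite mulrDr mulrA (mulrC p%:C z) (mulrC p%:C i%:R).
Qed.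

Lemma prod_pk_pochhammerE (R : realType) (m : nat) (p k : 'I_m -> R)
    (z : 'I_m -> R[i]) (n : nat) :
  \prod_(i < m) pk_pochhammer (p i) (k i) (z i) n =
  (\prod_(i < m) p i)%:C ^+ n * \prod_(i < m) pochhammer (z i / (k i)%:C) n.
Proof.
rewrite rmorph_prod -prodrXl -big_split.
by apply: eq_bigr => i _; exact: pk_pochhammerE.
Qed.

(** Stated between sequences, not at a fixed [n], so that it rewrites under [series]. *)
Lemma pk_hypergeometric_termE (R : realType) (r q : nat)
    (a : 'I_r -> R[i]) (p k : 'I_r -> R) (b : 'I_q -> R[i]) (t s : 'I_q -> R)
    (x : R[i]) :
  pk_hypergeometric_term a p k b t s x =
  hypergeometric_term (fun i => a i / (k i)%:C) (fun j => b j / (s j)%:C)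
    (((\prod_(i < r) p i) / (\prod_(j < q) t j))%:C * x).
Proof.
apply/funext => n; rewrite /pk_hypergeometric_term /hypergeometric_term.
rewrite !prod_pk_pochhammerE rmorphM fmorphV exprMn exprMn exprVn invfM.
(* [T] is already an inverse power; [P * T] is moved next to [x ^+ n]. *)
set P := _ ^+ n; set T := _ ^- n.
by rewrite [P * _ * _]mulrACA [P * T * _]mulrC -!mulrA.
Qed.

Theorem theorem4p1 (R : realType) (r q : nat)
    (a : 'I_r -> R[i]) (p k : 'I_r -> R) (b : 'I_q -> R[i]) (t s : 'I_q -> R)
    (p_gt0 : forall i, 0 < p i) (k_gt0 : forall i, 0 < k i)
    (t_gt0 : forall j, 0 < t j) (s_gt0 : forall j, 0 < s j)
    (b_s : forall (j : 'I_q) (m : nat), b j / (s j)%:C != - m%:R)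
    (x : R[i])
    (cvg_x : cvgn (series (pk_hypergeometric_term a p k b t s x))) :
  let alpha := fun i => a i / (k i)%:C in
  let beta := fun j => b j / (s j)%:C in
  let z := ((\prod_(i < r) p i) / (\prod_(j < q) t j))%:C * x in
  cvgn (series (hypergeometric_term alpha beta z)) /\
  pk_hypergeometric a p k b t s x = hypergeometric alpha beta z.
Proof.
move=> alpha beta z.
(* Both series are now the same sequence: convergence is [cvg_x], and the two limits coincide. *)
by rewrite /hypergeometric -pk_hypergeometric_termE.
Qed.
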